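(* Let $m,n,r,d$ be integers with $m,n\ge2$, $d\ge1$ and $0<r<\min\{m,n\}$. For each integer $a$ with $0\le a\le rd$ let $d_R=\lfloor a/r\rfloor$, $t_R=a \bmod r$, and define $$\mathcal{A}_a=\Big\{L(\lambda)R(\lambda): L\in\mathbb{C}[\lambda]^{m\times r},\ R\in\mathbb{C}[\lambda]^{r\times n},\ \deg(L_{*i})+\deg(R_{i*})=d\ (i=1,\dots,r),\ \textstyle\sum_{i=1}^r\deg(R_{i*})=a\Big\},$$ $$\mathcal{B}_a=\Big\{L(\lambda)R(\lambda): L\in\mathbb{C}[\lambda]^{m\times r},\ R\in\mathbb{C}[\lambda]^{r\times n},\ \deg(R_{i*})=d_R+1\ (1\le i\le t_R),\ \deg(R_{i*})=d_R\ (t_R<i\le r),\ \deg(L_{*i})=d-\deg(R_{i*})\ (1\le i\le r)\Big\}.$$ Then: (i) $\mathcal{B}_a\subseteq\mathcal{A}_a$ for $a=0,1,\dots,rd$; (ii) $\overline{\mathcal{B}_a}=\overline{\mathcal{A}_a}$ for $a=0,1,\dots,rd$; (iii) $\mathbb{C}[\lambda]^{m\times n}_{d,r}=\bigcup_{0\le a\le rd}\overline{\mathcal{B}_a}$; (iv) for every $P(\lambda)\in\mathbb{C}[\lambda]^{m\times n}_{d,r}$ there exists an integer $a$ with $P(\lambda)\in\overline{\mathcal{B}_a}$.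
   Context: $\mathbb{C}[\lambda]^{m\times n}_{d,r}$ is the set of complex $m\times n$ polynomial matrices of degree at most $d$ and normal rank (rank over $\mathbb{C}(\lambda)$) at most $r$. The degree of a polynomial vector is the maximum degree of its entries, with $\deg 0=-\infty$. $L_{*i}$ is the $i$th column of $L$, $R_{i*}$ the $i$th row of $R$. The space $\mathbb{C}[\lambda]^{m\times n}_d$ of polynomial matrices of degree at most $d$ is given the metric $\mathrm{dist}(P,Q)=(\sum_{i=0}^d\|P_i-Q_i\|_F^2)^{1/2}$ where $P=\sum_{i=0}^d\lambda^iP_i$, $Q=\sum_{i=0}^d\lambda^iQ_i$; closures $\overline{\mathcal{X}}$ are taken in this metric space. *)

(* Defs.v *)
From Stdlib Require Import Rdefinitions.
From HB Require Import structures.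
From mathcomp Require Import all_boot all_order all_algebra.
From mathcomp Require Import complex.
From mathcomp Require Import Rstruct.
Set Implicit Arguments. Unset Strict Implicit. Unset Printing Implicit Defensive.
Import Order.TTheory GRing.Theory Num.Theory.
Local Open Scope ring_scope.

Definition Cplx : Type := complex R.
Definition CC : numClosedFieldType := Cplx.

Notation pmat m n := 'M[{poly CC}]_(m, n).

(* degree of a polynomial vector (the maximum degree of its entries),
   with deg 0 = -oo encoded as None *)
Definition vdeg (k : nat) (v : 'I_k -> {poly CC}) : option nat :=
  if [forall i, v i == 0] then None
  else Some (\max_(i < k) size (v i)).-1.

Definition coldeg m r (L : pmat m r) (i : 'I_r) : option nat :=
  vdeg (fun j : 'I_m => L j i).
Definition rowdeg r n (Rm : pmat r n) (i : 'I_r) : option nat :=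
  vdeg (fun j : 'I_n => Rm i j).

Definition deg_le m n (d : nat) (P : pmat m n) : Prop :=
  forall i j, (size (P i j) <= d.+1)%N.

Definition normal_rank m n (P : pmat m n) : nat :=
  \rank (map_mx (@FracField.tofrac _) P : 'M[{fraction {poly CC}}]_(m, n)).

Definition PolyMatDR m n (d r : nat) (P : pmat m n) : Prop :=
  deg_le d P /\ (normal_rank P <= r)%N.

Definition sqmod (z : CC) : R :=
  (@complex.Re R z) ^+ 2 + (@complex.Im R z) ^+ 2.

Definition pdist m n (d : nat) (P Q : pmat m n) : R :=
  Num.sqrt (\sum_(k < d.+1) \sum_(i < m) \sum_(j < n)
              sqmod ((P i j)`_k - (Q i j)`_k)).

Definition pclosure m n (d : nat) (X : pmat m n -> Prop) (P : pmat m n) : Prop :=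
  deg_le d P /\
  forall eps : R, 0 < eps ->
    exists Q, deg_le d Q /\ X Q /\ pdist d P Q < eps.

Definition setA m n (r d a : nat) (P : pmat m n) : Prop :=
  exists (L : pmat m r) (Rm : pmat r n),
    P = L *m Rm /\
    exists dL dR : 'I_r -> nat,
      (forall i, coldeg L i = Some (dL i) /\ rowdeg Rm i = Some (dR i)
                 /\ (dL i + dR i = d)%N) /\
      (\sum_(i < r) dR i)%N = a.

Definition setB m n (r d a : nat) (P : pmat m n) : Prop :=
  exists (L : pmat m r) (Rm : pmat r n),
    P = L *m Rm /\
    forall i : 'I_r,
      let degRi := if (i < (a %% r)%N)%N then ((a %/ r)%N).+1 else (a %/ r)%N in
      rowdeg Rm i = Some degRi /\ coldeg L i = Some (d - degRi)%N.

(* Main.v *)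
(* A product L R whose row degrees e satisfy e(i1) >= e(i2) + 2 is a limit of
   products with e(i1) lowered and e(i2) raised by one; each such exchange
   decreases the sum of the squares of the degrees, so iterating it ends at the
   balanced degrees of B_a. Conversely, row reduction writes a matrix of degree d
   and rank k as L R with the leading coefficient rows of R independent, so that
   no cancellation of top coefficients occurs in L R and
   deg L_i + deg R_i <= d for every i; perturbing one entry of each column of L
   and of each row of R turns these bounds into equalities. Finally, rank <= r is
   a closed condition: a nonzero minor is nonzero at some point z, and evaluation
   at z is continuous. *)

Require Import Defs.
From Stdlib Require Import Rdefinitions.
From HB Require Import structures.
From mathcomp Require Import all_boot all_order all_algebra.
From mathcomp Require Import complex Rstruct.
From mathcomp Require Import perm zify ring lra.
Set Implicit Arguments.
Unset Strict Implicit.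
Unset Printing Implicit Defensive.
Import Order.TTheory GRing.Theory Num.Theory.
Local Open Scope ring_scope.

(** * The coefficient distance and closures *)

Lemma ler_term_sum (F : numDomainType) (I : finType) (f : I -> F) (i : I) :
  (forall j, 0 <= f j) -> f i <= \sum_j f j.
Proof. by move=> f0; rewrite (bigD1 i) //= lerDl sumr_ge0. Qed.

Lemma sqmodE (a b : R) : sqmod (Complex a b) = a ^+ 2 + b ^+ 2.
Proof. by []. Qed.

Lemma sqmodM (x y : CC) : sqmod (x * y) = sqmod x * sqmod y.
Proof.
case: x y => [a b] [c e].
change (sqmod (Complex (a * c - b * e) (a * e + b * c)) =
   sqmod (Complex a b) * sqmod (Complex c e)).
rewrite !sqmodE; ring.
Qed.

Lemma sqmodD_le (x y : CC) : sqmod (x + y) <= 2 * (sqmod x + sqmod y).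
Proof.
case: x y => [a b] [c e].
change (sqmod (Complex (a + c) (b + e)) <=
   2 * (sqmod (Complex a b) + sqmod (Complex c e))).
rewrite !sqmodE -subr_ge0.
have -> : 2 * (a ^+ 2 + b ^+ 2 + (c ^+ 2 + e ^+ 2)) - ((a + c) ^+ 2 + (b + e) ^+ 2)
  = (a - c) ^+ 2 + (b - e) ^+ 2 by ring.
by rewrite addr_ge0 ?sqr_ge0.
Qed.

Lemma sqmod_ge0 (x : CC) : 0 <= sqmod x.
Proof. by rewrite addr_ge0 ?sqr_ge0. Qed.

Lemma sqmodN (x : CC) : sqmod (- x) = sqmod x.
Proof.
case: x => [a b]; change (sqmod (Complex (- a) (- b)) = sqmod (Complex a b)).
by rewrite !sqmodE !sqrrN.
Qed.

Definition Rcplx (x : R) : CC := (real_complex R x : Cplx).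

Lemma sqmod_Rcplx (x : R) : sqmod (Rcplx x) = x ^+ 2.
Proof. by rewrite [LHS]sqmodE expr0n addr0. Qed.

Lemma norm_sqmod (x : CC) : `|x| ^+ 2 = Rcplx (sqmod x).
Proof.
case: x => a b; rewrite /Rcplx.
change ((real_complex R (Num.sqrt (a ^+ 2 + b ^+ 2)) : complex R) ^+ 2 =
  real_complex R (sqmod (Complex a b))).
by rewrite -rmorphXn sqr_sqrtr // addr_ge0 ?sqr_ge0.
Qed.

Lemma ltr_Rcplx (x y : R) : (Rcplx x < Rcplx y) = (x < y).
Proof. exact: ltcR. Qed.

Lemma sqmod_small (delta : CC) : 0 < delta ->
  exists2 eps : R, 0 < eps & forall x : CC, sqmod x < eps -> `|x| < delta.
Proof.
move=> d0; exists (sqmod delta).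
  have : 0 < `|delta| ^+ 2 by rewrite exprn_gt0 // normr_gt0 gt_eqF.
  by rewrite norm_sqmod -[0]/(Rcplx 0) ltr_Rcplx.
move=> x; rewrite -ltr_Rcplx -!norm_sqmod ltr_pXn2r ?nnegrE //.
by rewrite (gtr0_norm d0).
Qed.

Definition sqnorm {m n} (d : nat) (P : pmat m n) : R :=
  \sum_(k < d.+1) \sum_(i < m) \sum_(j < n) sqmod ((P i j)`_k).

Lemma sqnorm_ge0 m n d (P : pmat m n) : 0 <= sqnorm d P.
Proof. by do 3!apply: sumr_ge0 => ? _; exact: sqmod_ge0. Qed.

Lemma sqmod_le_sqnorm m n d (P : pmat m n) i j k :
  (k <= d)%N -> sqmod ((P i j)`_k) <= sqnorm d P.
Proof.
rewrite -ltnS => kd.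
pose F3 j' := sqmod (P i j')`_k.
pose F2 i' := \sum_(j' < n) sqmod (P i' j')`_k.
pose F1 (k' : 'I_d.+1) := \sum_(i' < m) \sum_(j' < n) sqmod (P i' j')`_k'.
apply: (@le_trans _ _ (F2 i)).
  by apply: (@ler_term_sum _ _ F3) => ?; exact: sqmod_ge0.
apply: (@le_trans _ _ (F1 (Ordinal kd))).
  by apply: (@ler_term_sum _ _ F2) => ?; apply: sumr_ge0 => ? _; exact: sqmod_ge0.
by apply: (@ler_term_sum _ _ F1) => ?; do 2!apply: sumr_ge0 => ? _; exact: sqmod_ge0.
Qed.

Lemma sqnormZ m n d (t : CC) (P : pmat m n) :
  sqnorm d (t%:P *: P) = sqmod t * sqnorm d P.
Proof.
rewrite /sqnorm; do 3!(rewrite mulr_sumr; apply: eq_bigr => ? _).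
by rewrite mxE coefCM sqmodM.
Qed.

Lemma sqnormD_le m n d (P Q : pmat m n) :
  sqnorm d (P + Q) <= 2 * (sqnorm d P + sqnorm d Q).
Proof.
rewrite /sqnorm -big_split mulr_sumr; apply: ler_sum => k _ /=.
rewrite -big_split mulr_sumr; apply: ler_sum => i _ /=.
rewrite -big_split mulr_sumr; apply: ler_sum => j _ /=.
by rewrite mxE coefD sqmodD_le.
Qed.

Lemma pdistE m n d (P Q : pmat m n) : pdist d P Q = Num.sqrt (sqnorm d (P - Q)).
Proof.
congr Num.sqrt; do 3!apply: eq_bigr => ? _.
by rewrite !mxE coefB.
Qed.

Lemma pclosureP m n d (X : pmat m n -> Prop) P :
  pclosure d X P <->
  deg_le d P /\ forall eps : R, 0 < eps ->
    exists Q, [/\ deg_le d Q, X Q & sqnorm d (P - Q) < eps].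
Proof.
split=> -[dP clP]; split=> // eps e0.
  have [|Q [dQ [XQ]]] := clP (Num.sqrt eps); first by rewrite sqrtr_gt0.
  by rewrite pdistE ltr_sqrt // => lt; exists Q.
have [|Q [dQ XQ lt]] := clP (eps ^+ 2); first by rewrite exprn_gt0.
exists Q; do 2!split=> //.
have -> : eps = Num.sqrt (eps ^+ 2) by rewrite sqrtr_sqr gtr0_norm.
by rewrite pdistE ltr_sqrt // exprn_gt0.
Qed.

Lemma pclosure_sub m n d (X Y : pmat m n -> Prop) P :
  (forall Q, X Q -> Y Q) -> pclosure d X P -> pclosure d Y P.
Proof.
move=> XY [dP clP]; split=> // eps /clP[Q [dQ [XQ lt]]].
by exists Q; do 2!split=> //; apply: XY.
Qed.

Lemma pclosure_idem m n d (X Y : pmat m n -> Prop) P :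
  (forall Q, X Q -> pclosure d Y Q) -> pclosure d X P -> pclosure d Y P.
Proof.
move=> XY /pclosureP[dP clP]; apply/pclosureP; split=> // eps e0.
(* [sqnormD_le] replaces the triangle inequality: two squared distances below [eps / 4] give one
   below [2 * (eps / 4 + eps / 4) = eps]. *)
have e4 : 0 < eps / 4 by lra.
have [Q [_ /XY/pclosureP[_ clQ] ltQ]] := clP _ e4.
have [S [dS YS ltS]] := clQ _ e4.
exists S; split=> //.
have -> : P - S = (P - Q) + (Q - S) by rewrite addrA subrK.
apply: le_lt_trans (sqnormD_le _ _ _) _; lra.
Qed.

(** The excluded values are 0, so that [t^-1] is available, and -1, because [perturb_exact] may
    scale a coefficient by [1 + t]. Small positive reals avoid both. *)
Lemma pclosure_line m n d (X : pmat m n -> Prop) (P E : pmat m n) :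
  deg_le d P -> deg_le d E ->
  (forall t : CC, t != 0 -> 1 + t != 0 -> X (P + t%:P *: E)) ->
  pclosure d X P.
Proof.
move=> dP dE XPE; apply/pclosureP; split=> // eps e0.
have n0 := sqnorm_ge0 d E.
(* With [s = sqnorm d E], this gives [x ^ 2 * s = eps * s / (4 * (1 + s)) < eps]; the added 1 keeps
   the denominator positive when [s = 0]. *)
pose x := Num.sqrt (eps / (1 + sqnorm d E)) / 2.
have q0 : 0 < eps / (1 + sqnorm d E) by rewrite divr_gt0 //; lra.
have x0 : 0 < x by rewrite divr_gt0 ?sqrtr_gt0 //; lra.
have Rne (y : R) : 0 < y -> Rcplx y != 0.
  by rewrite -ltr_Rcplx; move=> h; apply/eqP => e; move: h; rewrite e ltxx.
exists (P + (Rcplx x)%:P *: E); split.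
- move=> i j; rewrite !mxE mul_polyC (leq_trans (size_polyD _ _)) // geq_max dP.
  by rewrite (leq_trans (size_scale_leq _ _)) // dE.
- apply: XPE; first exact: Rne.
  have -> : 1 + Rcplx x = Rcplx (1 + x) by rewrite /Rcplx rmorphD rmorph1.
  by apply: Rne; rewrite addr_gt0.
rewrite opprD addrA subrr add0r -scaleNr -polyCN sqnormZ sqmodN sqmod_Rcplx.
rewrite /x exprMn sqr_sqrtr ?(ltW q0) //.
move: (sqnorm d E) n0 => s n0.
have -> : eps / (1 + s) * 2^-1 ^+ 2 * s = eps * (s / (4 * (1 + s))).
  by field; lra.
rewrite -[ltRHS]mulr1 ltr_pM2l // ltr_pdivrMr; lra.
Qed.

(** * Balancing the degrees *)

Lemma vdegP k (v : 'I_k -> {poly CC}) (e : nat) :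
  vdeg v = Some e <->
  (forall i, (size (v i) <= e.+1)%N) /\ exists i, (v i)`_e != 0.
Proof.
have le_max i : (size (v i) <= \max_(i < k) size (v i))%N.
  exact: (@leq_bigmax _ (fun i => size (v i))).
rewrite /vdeg; case: ifPn => [/forallP v0 | /forallPn [i0 vi0]]; split=> //.
- by move=> [_ [i vi]]; move: vi; rewrite (eqP (v0 i)) coef0 eqxx.
- move=> [<-].
  have mx_gt0 : (0 < \max_(i < k) size (v i))%N.
    by apply: leq_trans (le_max i0); rewrite size_poly_gt0.
  rewrite prednK //; split=> [i|]; first exact: le_max.
  have [|i mx] := @bigop.eq_bigmax 'I_k (fun i => size (v i)).
    by apply/card_gt0P; exists i0.
  exists i; rewrite mx -/(lead_coef _) lead_coef_eq0 -size_poly_gt0 -mx //.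
move=> [sz [i vi]]; congr Some; apply/eqP.
have lt : (e < size (v i))%N.
  by rewrite ltnNge; apply: contraNN vi => le; rewrite nth_default.
have mx : (e < \max_(i < k) size (v i))%N by apply: leq_trans lt (le_max i).
rewrite -eqSS prednK ?(leq_ltn_trans _ mx) // eqn_leq mx andbT.
by apply/bigmax_leqP.
Qed.

(** Common form of both families: [setB] prescribes one [e], [setA] allows every [e] with sum [a].
    The bound [e i <= d] makes the truncated [d - e i] a true difference. *)
Definition profile {m n r} (d : nat) (e : 'I_r -> nat) (P : pmat m n) : Prop :=
  exists (L : pmat m r) (Rm : pmat r n),
    P = L *m Rm /\
    forall i, [/\ (e i <= d)%N, rowdeg Rm i = Some (e i)
                & coldeg L i = Some (d - e i)%N].

Lemma size_mul_bound (p q : {poly CC}) (a b : nat) :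
  (size p <= a.+1)%N -> (size q <= b.+1)%N -> (size (p * q)%R <= (a + b).+1)%N.
Proof.
move=> pa qb; apply: leq_trans (size_polyMleq _ _) _.
by move: pa qb; case: (size p) => [|k]; case: (size q) => [|l] /=; lia.
Qed.

Lemma deg_le_mul m r n d (e : 'I_r -> nat) (L : pmat m r) (Rm : pmat r n) :
  (forall i, (e i <= d)%N) ->
  (forall j i, (size (L j i) <= (d - e i).+1)%N) ->
  (forall i k, (size (Rm i k) <= (e i).+1)%N) -> deg_le d (L *m Rm).
Proof.
move=> ed Ld Re j k; rewrite mxE; apply: leq_trans (size_sum _ _ _) _.
apply/bigmax_leqP => i _; rewrite -(subnK (ed i)).
exact: size_mul_bound.
Qed.

Lemma profile_deg_le m n r d e (P : pmat m n) : @profile m n r d e P -> deg_le d P.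
Proof.
case=> L [Rm [-> H]]; apply: (@deg_le_mul _ _ _ _ e) => [i|j i|i k];
  by have [? /vdegP[? _] /vdegP[? _]] := H i.
Qed.

Lemma profile_perm m n r d e (s : 'S_r) (P : pmat m n) :
  profile d e P -> profile d (e \o s) P.
Proof.
case=> L [Rm [-> H]].
exists (\matrix_(j, i) L j (s i)), (\matrix_(i, k) Rm (s i) k); split.
  apply/matrixP => j k; rewrite !mxE (reindex_perm s).
  by apply: eq_bigr => i _; rewrite !mxE.
move=> i; have [? /vdegP[Rs [k Rk]] /vdegP[Ls [j Lj]]] := H (s i).
split=> //; apply/vdegP; split=> [i'|]; rewrite ?mxE //.
  by exists k; rewrite mxE.
by exists j; rewrite mxE.
Qed.

Lemma poly_drop1 (p : {poly CC}) : p = (p`_0)%:P + 'X * drop_poly 1 p.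
Proof.
apply/polyP => i; rewrite coefD coefC coefXM coef_drop_poly.
by case: i => [|i]; rewrite /= ?addr0 // addn1 add0r.
Qed.

Definition shift_deg {r} (e : 'I_r -> nat) (i1 i2 i : 'I_r) : nat :=
  if i == i1 then (e i1).-1 else if i == i2 then (e i2).+1 else e i.

Lemma size_le_coef (p : {poly CC}) (a : nat) :
  (forall k, (a < k)%N -> p`_k = 0) -> (size p <= a.+1)%N.
Proof. by move=> H; apply/leq_sizeP => k; apply: H. Qed.

(* With [X = lambda], [S1 = (R1 - R1(0)) / X] and [S2 = (L2 - L2(0)) / X],
   [L1 R1 + L2 R2 + t (S2 R1(0) - L2(0) S1)
      = (L2(0) - X / t L1) (R2 - t S1) + (L1 + t S2) (R1(0) + X / t R2)]:
   the left-hand side tends to [L1 R1 + L2 R2] as [t] tends to [0], whereas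
   the right-hand side has the more balanced row degrees. It is the explicit form
   of the deformation of O(e1) + O(e2) to O(e1 - 1) + O(e2 + 1) on the
   projective line. *)
Lemma profile_shift m n r d e (i1 i2 : 'I_r) (P : pmat m n) :
  ((e i2).+2 <= e i1)%N -> profile d e P ->
  pclosure d (profile d (shift_deg e i1 i2)) P.
Proof.
move=> le12 prP; have dP := profile_deg_le prP; case: prP dP => L [Rm [PE H]] dP.
have ne21 : (i2 == i1) = false.
  by apply/eqP => E; move: le12; rewrite E ltnNge leqnSn.
have ed i : (e i <= d)%N by have [] := H i.
have Rs i k : (size (Rm i k) <= (e i).+1)%N by have [_ /vdegP[]] := H i.
have Ls j i : (size (L j i) <= (d - e i).+1)%N by have [_ _ /vdegP[]] := H i.
have Rex i : exists k, (Rm i k)`_(e i) != 0 by have [_ /vdegP[]] := H i.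
have Lex i : exists j, (L j i)`_(d - e i) != 0 by have [_ _ /vdegP[]] := H i.
pose S1 k := drop_poly 1 (Rm i1 k).
pose S2 j := drop_poly 1 (L j i2).
pose E : pmat m n := \matrix_(j, k) (S2 j * ((Rm i1 k)`_0)%:P - ((L j i2)`_0)%:P * S1 k).
have S1s k : (size (S1 k) <= e i1)%N.
  by rewrite size_drop_poly; have := Rs i1 k; lia.
have S2s j : (size (S2 j) <= d - e i2)%N.
  by rewrite size_drop_poly; have := Ls j i2; lia.
apply: (@pclosure_line _ _ _ _ _ E) => // [j k|t t0 _].
  rewrite mxE [_%:P * S1 k]mulrC; apply: leq_trans (size_polyD _ _) _.
  rewrite size_polyN geq_max -{1}(addn0 d) -{2}(addn0 d).
  apply/andP; split; apply: size_mul_bound; rewrite ?size_polyC ?leq_b1 //.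
    by have := S2s j; lia.
  by have := S1s k; have := ed i1; lia.
exists (\matrix_(j, i) if i == i1 then ((L j i2)`_0)%:P - (t^-1)%:P * 'X * L j i1
   else if i == i2 then L j i1 + t%:P * S2 j else L j i).
exists (\matrix_(i, k) if i == i1 then Rm i2 k - t%:P * S1 k
   else if i == i2 then ((Rm i1 k)`_0)%:P + (t^-1)%:P * 'X * Rm i2 k else Rm i k).
split.
  apply/matrixP => j k; rewrite PE !mxE.
  rewrite (bigD1 i1) // (bigD1 i2) ?ne21 //=.
  rewrite [RHS](bigD1 i1) // [in RHS](bigD1 i2) ?ne21 //=.
  rewrite !mxE eqxx ne21 eqxx.
  set T := \sum_(i < r | _) _; have -> : \sum_(i < r | (i != i1) && (i != i2))
    (\matrix_(j, i) (if i == i1 then ((L j i2)`_0)%:P - (t^-1)%:P * 'X * L j i1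
   else if i == i2 then L j i1 + t%:P * S2 j else L j i)) j i *
    (\matrix_(i, k) (if i == i1 then Rm i2 k - t%:P * S1 k
   else if i == i2 then ((Rm i1 k)`_0)%:P + (t^-1)%:P * 'X * Rm i2 k else Rm i k)) i k = T.
    by apply: eq_bigr => i /andP[/negPf n1 /negPf n2]; rewrite !mxE n1 n2.
  rewrite !addrA [LHS]addrAC; congr (_ + T).
  have tV : t%:P * (t^-1)%:P = 1 :> {poly CC} by rewrite -polyCM divff.
  rewrite {1}[Rm i1 k]poly_drop1 {1}[L j i2]poly_drop1 -/(S1 k) -/(S2 j).
  move: (_`_0)%:P (_`_0)%:P (S1 k) (S2 j) (t%:P) (t^-1)%:P tV => a b s1 s2 u v uv.
  (* The expansion isolates the factors [u * v = t * t^-1], so that no inverse of [t] survives in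
     the product. *)
  have -> : (a - v * 'X * L j i1) * (Rm i2 k - u * s1) + (L j i1 + u * s2) * (b + v * 'X * Rm i2 k)
   = a * Rm i2 k - u * a * s1 + (u * v) * ('X * L j i1 * s1) + L j i1 * b + u * s2 * b
     + (u * v) * ('X * s2 * Rm i2 k) by ring.
  by rewrite uv !mul1r; ring.
have coefXc (p : {poly CC}) (q : CC) l : (q%:P * 'X * p)`_l.+1 = q * p`_l.
  by rewrite -mulrA coefCM coefXM.
have tV0 : t^-1 != 0 by rewrite invr_eq0.
move=> i; rewrite /shift_deg; case: (eqVneq i i1) => [->|n1].
  have lt1 : (0 < e i1)%N by lia.
  split; first by have := ed i1; lia.
    apply/vdegP; split=> [k|].
      rewrite mxE eqxx prednK //; apply: leq_trans (size_polyD _ _) _.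
      rewrite size_polyN geq_max (leq_trans (Rs _ _)) //=; last lia.
      by rewrite mul_polyC (leq_trans (size_scale_leq _ _)).
    have [k Rk] := Rex i1; exists k.
    rewrite mxE eqxx coefB coefCM coef_drop_poly addn1 prednK //.
    (* The gap of two is used here: [Rm i2] has degree below [e i1 - 1], so the top coefficient
       comes from [S1] alone. *)
    rewrite nth_default ?sub0r ?oppr_eq0 ?mulf_neq0 //.
    by apply: leq_trans (Rs _ _) _; lia.
  have -> : (d - (e i1).-1 = (d - e i1).+1)%N by have := ed i1; lia.
  apply/vdegP; split=> [j|].
    rewrite mxE eqxx; apply: size_le_coef => -[|k] // lek.
    rewrite coefB coefC /= sub0r coefXc nth_default ?mulr0 ?oppr0 //.
    exact: leq_trans (Ls _ _) lek.
  have [j Lj] := Lex i1; exists j.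
  by rewrite mxE eqxx coefB coefC /= sub0r coefXc oppr_eq0 mulf_neq0.
case: (eqVneq i i2) => [->|n2].
  have e1d := ed i1.
  split; first by lia.
    apply/vdegP; split=> [k|].
      rewrite mxE ne21 eqxx; apply: size_le_coef => -[|l] // lel.
      rewrite coefD coefC /= add0r coefXc nth_default ?mulr0 //.
      exact: leq_trans (Rs _ _) lel.
    have [k Rk] := Rex i2; exists k.
    by rewrite mxE ne21 eqxx coefD coefC /= add0r coefXc mulf_neq0.
  have dE : (d - e i2 = (d - (e i2).+1).+1)%N by lia.
  apply/vdegP; split=> [j|].
    rewrite mxE ne21 eqxx -dE; apply: leq_trans (size_polyD _ _) _.
    rewrite geq_max (leq_trans (Ls _ _)) //=; last by lia.
    by rewrite mul_polyC (leq_trans (size_scale_leq _ _)).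
  have [j Lj] := Lex i2; exists j.
  rewrite mxE ne21 eqxx coefD coefCM coef_drop_poly addn1 -dE.
  (* The same gap on the column side: [L j i1] has degree at most [d - e i1 < d - e i2 - 1]. *)
  rewrite nth_default ?add0r ?mulf_neq0 //.
  by apply: leq_trans (Ls _ _) _; lia.
split=> //; apply/vdegP; split=> [k|].
- by rewrite mxE (negPf n1) (negPf n2).
- by have [k Rk] := Rex i; exists k; rewrite mxE (negPf n1) (negPf n2).
- by rewrite mxE (negPf n1) (negPf n2).
- by have [k Rk] := Lex i; exists k; rewrite mxE (negPf n1) (negPf n2).
Qed.

(** * Balanced degree sequences *)

Definition balanced (r a i : nat) : nat :=
  if (i < (a %% r))%N then ((a %/ r)%N).+1 else (a %/ r)%N.

Lemma sum_balanced r a : (0 < r)%N -> (\sum_(i < r) balanced r a i)%N = a.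
Proof.
move=> r0; rewrite (eq_bigr (fun i : 'I_r => a %/ r + (i < a %% r))%N); last first.
  by move=> i _; rewrite /balanced; case: ifP; rewrite ?addn1 ?addn0.
rewrite big_split /= sum_nat_const card_ord {3}(divn_eq a r) [(r * _)%N]mulnC.
congr (_ + _)%N.
rewrite -[LHS](big_mkord xpredT (fun i => nat_of_bool (i < a %% r)%N)).
rewrite (big_cat_nat _ (n := (a %% r)%N)) //= ?(ltnW (ltn_pmod a r0)) //.
rewrite [X in (_ + X)%N]big_nat_cond [X in (_ + X)%N]big1 ?addn0; last first.
  by move=> i /andP[/andP[le _] _]; rewrite ltnNge le.
rewrite big_nat_cond (eq_bigr (fun=> 1%N)); last first.
  by move=> i /andP[/andP[_ ->] _].
by rewrite -big_nat_cond sum_nat_const_nat muln1 subn0.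
Qed.

(** If the larger value [a %/ r + 1] occurs, then [a %% r > 0], and [a <= r * d] forces
    [a %/ r < d]. *)
Lemma balanced_le r d a i : (0 < r)%N -> (a <= r * d)%N -> (balanced r a i <= d)%N.
Proof.
move=> r0 ard; rewrite /balanced; have := divn_eq a r; have := ltn_pmod a r0.
case: ifP; nia.
Qed.

Lemma setB_profile m n r d a (P : pmat m n) : (0 < r)%N -> (a <= r * d)%N ->
  setB r d a P <-> profile d (fun i : 'I_r => balanced r a i) P.
Proof.
move=> r0 ard; split=> -[L [Rm [PE H]]]; exists L, Rm; split=> // i.
  by have [? ?] := H i; split=> //; apply: balanced_le.
by have [_ ? ?] := H i; split.
Qed.

Lemma setA_profile m n r d a (P : pmat m n) :
  setA r d a P <->
  exists2 e : 'I_r -> nat, (\sum_(i < r) e i)%N = a & profile d e P.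
Proof.
split=> [[L [Rm [PE [dL [dR [H sumE]]]]]]|[e sumE [L [Rm [PE H]]]]].
  exists dR => //; exists L, Rm; split=> // i; have [-> [-> <-]] := H i.
  by rewrite leq_addl addnK.
exists L, Rm; split=> //; exists (fun i => d - e i)%N, e; split=> // i.
by have [? ? ?] := H i; rewrite subnK.
Qed.

(** With [S] the total excess over [q], exactly [S] values are [q + 1] and [r - S] are [q]. So [q]
    and [S] determine the multiset of values; the identity is arranged without subtraction. *)
Lemma count_two_values r (f : 'I_r -> nat) (q : nat) (p : pred nat) :
  (forall i, (q <= f i <= q.+1)%N) ->
  (count p (codom f) + p q * \sum_(i < r) (f i - q) =
     r * p q + p q.+1 * \sum_(i < r) (f i - q))%N.
Proof.
move=> fq; rewrite codomE count_map -sum1_count big_mkcond /= big_enum /=.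
rewrite !big_distrr -[r in (r * _)%N]card_ord -sum_nat_const -!big_split /=.
apply: eq_bigr => i _; have /andP[] := fq i; rewrite leq_eqVlt.
case/predU1P=> [<-|qf fq1]; first by rewrite subnn; case: (p q); lia.
have -> : f i = q.+1 by lia.
by rewrite subSnn; case: (p q); case: (p q.+1); lia.
Qed.

(** All values lie in [{q, q + 1}] for the minimum [q], and the total excess is below [r]. Hence [q]
    and the excess are the quotient and remainder of the sum by [r], as for [balanced], and the two
    multisets agree. *)
Lemma balanced_perm r (e : 'I_r -> nat) :
  (0 < r)%N -> (forall i j, (e i <= (e j).+1)%N) ->
  exists s : 'S_r, forall i, e (s i) = balanced r (\sum_(j < r) e j) i.
Proof.
move=> r0 eij; set a := (\sum_(j < r) e j)%N.
have [i0 _ i0min] := @arg_minnP 'I_r (Ordinal r0) xpredT e isT.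
pose q := e i0; have eq i : (q <= e i <= q.+1)%N by rewrite i0min //= eij.
have sum_sub f : (forall i : 'I_r, q <= f i <= q.+1)%N ->
    (r * q + \sum_(i < r) (f i - q) = \sum_(i < r) f i)%N.
  move=> fq; rewrite -[r in (r * _)%N]card_ord -sum_nat_const -big_split /=.
  by apply: eq_bigr => i _; rewrite subnKC //; have /andP[] := fq i.
have aE : (r * q + \sum_(i < r) (e i - q) = a)%N by apply: sum_sub.
(* The index [i0] of the minimum has excess 0, every other index at most 1. *)
have lt_r : (\sum_(i < r) (e i - q) < r)%N.
  rewrite -[r in (_ < r)%N](card_ord r) -sum1_card (bigD1 i0) //=.
  rewrite [X in (_ < X)%N](bigD1 i0) //=.
  rewrite subnn add0n add1n ltnS; apply: leq_sum => i _.
  by have := eq i; lia.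
have qE : (a %/ r)%N = q.
  by rewrite -aE mulnC divnMDl // divn_small // addn0.
pose b (i : 'I_r) := balanced r a i.
have bq i : (q <= b i <= q.+1)%N.
  by rewrite /b /balanced qE; case: ifP; rewrite leqnn leqnSn.
have sE : (\sum_(i < r) (b i - q) = \sum_(i < r) (e i - q))%N.
  by apply: (@addnI (r * q)); rewrite aE sum_sub // sum_balanced.
have perm : perm_eq [tuple b i | i < r] [tuple e i | i < r].
  apply/seq.permP => p; rewrite /= -!codomE.
  have := count_two_values p bq; have := count_two_values p eq.
  by rewrite sE => <- /addIn.
have /tuple_permP[s sP] := perm; exists s => i.
have /(congr1 (fun t : r.-tuple nat => tnth t i)) : [tuple b i | i < r] =
   [tuple tnth [tuple e i | i < r] (s i) | i < r] by apply: val_inj.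
by rewrite !tnth_mktuple.
Qed.

(** Used with the identity, to see that the sum is kept, and with the square, to see that the
    induction measure drops. *)
Lemma sum_shift_deg r (e : 'I_r -> nat) i1 i2 (f : nat -> nat) : i1 != i2 ->
  (\sum_(i < r) f (shift_deg e i1 i2 i) + (f (e i1) + f (e i2)) =
   \sum_(i < r) f (e i) + (f (e i1).-1 + f (e i2).+1))%N.
Proof.
move=> ne; have ne' : i2 != i1 by rewrite eq_sym.
rewrite (bigD1 i1) // (bigD1 i2) //= [in RHS](bigD1 i1) // [in RHS](bigD1 i2) //=.
rewrite /shift_deg eqxx eqxx (negPf ne').
rewrite (eq_bigr (fun i => f (e i))); first by lia.
by move=> i /andP[/negPf-> /negPf->].
Qed.

Lemma profile_balanced m n r d (e : 'I_r -> nat) (P : pmat m n) : (0 < r)%N ->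
  profile d e P ->
  pclosure d (profile d (fun i : 'I_r => balanced r (\sum_(j < r) e j) i)) P.
Proof.
move=> r0; have [N] := ubnP (\sum_(i < r) e i ^ 2)%N.
elim: N e P => // N IH e P leN prP.
have [/forallP bal|/forallPn[i1 /forallPn[i2]]] :=
  boolP [forall i1, forall i2, (e i1 <= (e i2).+1)%N].
  have [i j|s sE] := @balanced_perm r e r0; first exact: (forallP (bal i)).
  have prPs := profile_perm s prP.
  apply/pclosureP; split=> [|eps e0]; first exact: profile_deg_le prP.
  exists P; split; first exact: profile_deg_le prP.
    case: prPs => L [Rm [PE H]]; exists L, Rm; split=> // i.
    by rewrite -sE; apply: H.
  rewrite subrr (_ : sqnorm d 0 = 0) //.
  by do 3!apply: big1 => ? _; rewrite mxE coef0 sqmodE expr0n addr0.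
rewrite -ltnNge => lt12; have ne : i1 != i2.
  by apply/eqP => E; move: lt12; rewrite E ltnNge leqnSn.
apply: pclosure_idem (profile_shift lt12 prP) => Q prQ.
have := @sum_shift_deg r e i1 i2 (fun k => k) ne.
have := @sum_shift_deg r e i1 i2 (fun k => k ^ 2)%N ne.
rewrite /= => sum2 sum1.
have -> : (\sum_(j < r) e j = \sum_(j < r) shift_deg e i1 i2 j)%N.
  apply: (@addIn (e i1 + e i2)); rewrite sum1; congr addn; lia.
apply: IH => //.
(* The decrease is [2 * (e i1 - e i2 - 1)], positive by the gap of two. *)
have : ((e i1).-1 ^ 2 + (e i2).+1 ^ 2 < e i1 ^ 2 + e i2 ^ 2)%N.
  by case: (e i1) lt12 => [|k] //= ; rewrite !expnS !expn0 !muln1; nia.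
move=> lt; rewrite -(ltn_add2r (e i1 ^ 2 + e i2 ^ 2)) sum2.
by rewrite -addnS; apply: leq_add.
Qed.

Lemma setA_sub_closure_setB m n r d a (P : pmat m n) :
  (0 < r)%N -> (a <= r * d)%N -> setA r d a P -> pclosure d (setB r d a) P.
Proof.
move=> r0 ard /setA_profile[e <- prP].
apply: pclosure_sub (profile_balanced r0 prP) => Q; apply: (setB_profile _ r0 _).2.
rewrite -[r in (r * d)%N]card_ord -sum_nat_const; apply: leq_sum => i _.
by case: prP => L [Rm [_ /(_ i)[]]].
Qed.

Lemma setB_sub_setA m n r d a (P : pmat m n) :
  (0 < r)%N -> (a <= r * d)%N -> setB r d a P -> setA r d a P.
Proof.
move=> r0 ard /(setB_profile _ r0 ard) prP; apply/setA_profile.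
by exists (fun i : 'I_r => balanced r a i); first exact: sum_balanced.
Qed.

(** * Row reduction *)

(* If the leading coefficient rows are independent, the top
   coefficients of the [w i * A i j] cannot cancel. *)
Lemma predictable_degree (F : fieldType) k n (A : 'M[{poly F}]_(k, n))
    (s : 'I_k -> nat) (w : 'I_k -> {poly F}) (D : nat) :
  (forall i, 0 < s i)%N ->
  (forall i j, size (A i j) <= s i)%N ->
  row_free (\matrix_(i, j) (A i j)`_(s i).-1) ->
  (forall j, size (\sum_i w i * A i j)%R <= D)%N ->
  forall i, w i != 0 -> (size (w i) + s i <= D.+1)%N.
Proof.
move=> s0 As freeA wAD i wi0.
have [i1 wi1 i1max] :=
  @arg_maxnP _ i (fun i => w i != 0) (fun i => size (w i) + s i)%N wi0.
apply: leq_trans (i1max _ wi0) _; rewrite leqNgt; apply/negP => ltD.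
set T := (size (w i1) + s i1)%N in i1max ltD.
(* [T.-2] is the largest degree that a product [w i * A i j] can reach. The entry [c i] is the
   coefficient of [w i] that meets the leading row of [A] there, so [c] times the leading matrix is
   the coefficient of the sum at [T.-2], which is 0 since [D <= T.-2]. *)
pose c : 'rV[F]_k := \row_i (if w i == 0 then 0 else (w i)`_(T - s i).-1).
suff : c = 0.
  move/rowP/(_ i1); rewrite !mxE (negPf wi1) /T addnK => /eqP.
  by rewrite -/(lead_coef _) lead_coef_eq0 (negPf wi1).
apply/eqP; rewrite -(mulmx_free_eq0 _ freeA); apply/eqP/rowP => j; rewrite !mxE.
have top0 : (\sum_i w i * A i j)`_T.-2 = 0.
  by rewrite nth_default // (leq_trans (wAD j)) //; lia.
rewrite -[RHS]top0 coef_sum; apply: eq_bigr => l _; rewrite !mxE.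
case: eqVneq => [->|wl0]; first by rewrite !mul0r coef0.
have le := i1max _ wl0; have wl1 : (0 < size (w l))%N by rewrite size_poly_gt0.
have sl := s0 l.
have lt : ((T - s l).-1 < T.-2.+1)%N by lia.
rewrite coefM (bigD1 (Ordinal lt)) //= big1 ?addr0 => [|h hne].
  by congr (_ * _`_ _); lia.
have {hne} hne : (nat_of_ord h != (T - s l).-1)%N by [].
(* Below this index the cofactor from [A l j] vanishes, above it that from [w l]. *)
have [hlt|hge] := ltnP h (T - s l).-1.
  by rewrite (nth_default _ (s := A l j)) ?mulr0 // (leq_trans (As _ _)) //; lia.
by rewrite (nth_default _ (s := w l)) ?mul0r //; lia.
Qed.

(** Induction on the sum of [(s i).+1]: a row with [s i = 0] is zero and is deleted (the successor
    makes this a decrease), and a relation among leading rows allows one [s i] to be lowered. [M]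
    records that the rows of [A] stay in the row module of [P]. *)
Lemma row_reduction (F : fieldType) m n (P : 'M[{poly F}]_(m, n)) :
  exists k (L : 'M[{poly F}]_(m, k)) (A : 'M[{poly F}]_(k, n))
         (M : 'M[{poly F}]_(k, m)) (s : 'I_k -> nat),
    [/\ P = L *m A, A = M *m P, forall i, (0 < s i)%N,
        forall i j, (size (A i j) <= s i)%N
      & row_free (\matrix_(i, j) (A i j)`_(s i).-1)].
Proof.
suff main N : forall k (L : 'M[{poly F}]_(m, k)) (A : 'M[{poly F}]_(k, n))
    (M : 'M[{poly F}]_(k, m)) (s : 'I_k -> nat),
    (\sum_i (s i).+1 < N)%N -> P = L *m A -> A = M *m P ->
    (forall i j, size (A i j) <= s i)%N ->
  exists k (L : 'M[{poly F}]_(m, k)) (A : 'M[{poly F}]_(k, n))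
         (M : 'M[{poly F}]_(k, m)) (s : 'I_k -> nat),
    [/\ P = L *m A, A = M *m P, forall i, (0 < s i)%N,
        forall i j, (size (A i j) <= s i)%N
      & row_free (\matrix_(i, j) (A i j)`_(s i).-1)].
  apply: (main _ m 1%:M P 1%:M (fun i => \max_j size (P i j)) (ltnSn _)) => [||i j].
  - by rewrite mul1mx.
  - by rewrite mul1mx.
  exact: (@leq_bigmax _ (fun j => size (P i j))).
elim: N => // N IH k L A M s ltN PE AE As.
have [/forallP s0|/forallPn[i0]] := boolP [forall i, (0 < s i)%N]; last first.
  rewrite -eqn0Ngt => /eqP si0.
  case: k i0 L A M s si0 ltN PE AE As => [[]//|k] i0 L A M s si0 ltN PE AE As.
  have A0 j : A i0 j = 0.
    by apply/eqP; rewrite -size_poly_eq0 -leqn0 -si0 As.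
  apply: (IH k (colsub (lift i0) L) (rowsub (lift i0) A) (rowsub (lift i0) M)
            (fun i => s (lift i0 i))).
  - by move: ltN; rewrite (bigD1_ord i0) //= si0 add1n ltnS.
  - apply/matrixP => i j; rewrite PE !mxE (bigD1_ord i0) //= A0 mulr0 add0r.
    by apply: eq_bigr => l _; rewrite !mxE.
  - by rewrite {1}AE mul_rowsub_mx.
  - by move=> i j; rewrite mxE.
set H := \matrix_(i, j) (A i j)`_(s i).-1.
have [freeH|] := boolP (row_free H); first by exists k, L, A, M, s.
rewrite -kermx_eq0 => /rowV0Pn[c /sub_kermxP cH /rV0Pn[i' ci']].
(* The row of largest [s] in the relation is the one replaced, so that the exponents [s i0 - s i]
   below are true differences whenever [c 0 i] is nonzero. *)
have [i0 ci0 i0max] := @arg_maxnP _ i' (fun i => c 0 i != 0) s ci'.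
pose f i : {poly F} := (c 0 i / c 0 i0)%:P * 'X^(s i0 - s i).
pose b : 'rV[{poly F}]_k := \row_i (if i == i0 then 0 else f i).
(* [B] is a column times a row with product 0 in the other order, so [B] squares to 0 and the row
   operation [1 + B] has inverse [1 - B]. *)
pose B : 'M[{poly F}]_k := delta_mx i0 0 *m b.
have BB : B *m B = 0.
  rewrite /B mulmxA -(mulmxA (delta_mx i0 0)).
  rewrite (_ : b *m delta_mx i0 0 = 0) ?mulmx0 ?mul0mx //.
  by apply/rowP => j; rewrite -colE !mxE eqxx.
have unipotent : (1%:M - B) *m (1%:M + B) = 1%:M.
  by rewrite mulmxDr mulmx1 mulmxBl mul1mx BB subr0 subrK.
have BAE i j : (B *m A) i j = if i == i0 then \sum_l b 0 l * A l j else 0.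
  rewrite /B -mulmxA mxE big_ord1 !mxE andbT eq_sym.
  by case: (i0 =P i) => _; rewrite /= ?mul1r ?mul0r.
pose s' i := if i == i0 then (s i).-1 else s i.
apply: (IH k (L *m (1%:M - B)) ((1%:M + B) *m A) ((1%:M + B) *m M) s').
- move: ltN; rewrite ltnS => /(leq_trans _); apply.
  rewrite (bigD1 i0) //= [X in (_ < X)%N](bigD1 i0) //= /s' eqxx.
  rewrite (eq_bigr (fun i => (s i).+1)) => [|i /negPf-> //].
  by rewrite prednK ?s0.
- by rewrite mulmxA -(mulmxA L) unipotent mulmx1.
- by rewrite -mulmxA -AE.
move=> i j; rewrite mulmxDl mul1mx mxE BAE /s'.
case: eqVneq => [->|_]; last by rewrite addr0.
have -> : A i0 j + \sum_l b 0 l * A l j = \sum_l f l * A l j.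
  rewrite (bigD1 i0) //= [RHS](bigD1 i0) //= mxE eqxx mul0r add0r; congr (_ + _).
    by rewrite /f divff // subnn expr0 mulr1 mul1r.
  by apply: eq_bigr => l /negPf lne; rewrite mxE lne.
apply/leq_sizeP => h hs; rewrite coef_sum.
(* From index [(s i0).-1] on, only that index can contribute, and there the sum is the relation [cH]
   divided by [c 0 i0]. *)
have term l : (f l * A l j)`_h =
    c 0 l / c 0 i0 * (if h == (s i0).-1 then H l j else 0).
  rewrite /f -mulrA coefCM coefXnM mxE.
  have [->|cl] := eqVneq (c 0 l) 0; first by rewrite !mul0r.
  have le := i0max l cl; have sl := s0 l; congr (_ * _).
  case: eqVneq => [->|hne].
    have -> : ((s i0).-1 < s i0 - s l)%N = false by lia.
    by congr (_`_ _); lia.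
  case: ifP => // _; rewrite nth_default // (leq_trans (As _ _)) //.
  by have := s0 i0; lia.
rewrite (eq_bigr _ (fun l _ => term l)); case: eqVneq => _; last first.
  by rewrite big1 // => l _; rewrite mulr0.
have /rowP/(_ j) := cH; rewrite !mxE => cHj.
rewrite (eq_bigr (fun l => (c 0 i0)^-1 * (c 0 l * H l j))); last first.
  by move=> l _; rewrite mulrCA mulrA.
by rewrite -mulr_sumr cHj mulr0.
Qed.

(** * Independence over the fraction field and the rank factorization *)

Lemma frac_clear_denom (D : idomainType) (x : {fraction D}) :
  exists2 q : D, q != 0 & exists p : D, @FracField.tofrac D q * x = @FracField.tofrac D p.
Proof.
elim/quotW: x => y; exists (\d_y); first exact: denom_ratioP.
exists (\n_y); unlock FracField.tofrac; rewrite -[LHS]FracField.pi_mul.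
apply/eqmodP; rewrite /= FracField.equivfE /FracField.mulf /=.
by rewrite !numden_Ratio ?mulf_neq0 ?oner_eq0 ?denom_ratioP // mul1r mulr1 mulrC.
Qed.

Lemma frac_row_clear_denom (D : idomainType) k (v : 'rV[{fraction D}]_k) :
  exists2 q : D, q != 0 &
    exists w : 'rV[D]_k, @FracField.tofrac D q *: v = map_mx (@FracField.tofrac D) w.
Proof.
have /fin_all_exists[q qP] i : exists q, q != 0 /\
    exists p : D, @FracField.tofrac D q * v 0 i = @FracField.tofrac D p.
  by have [q q0 qv] := frac_clear_denom (v 0 i); exists q.
have /fin_all_exists[p pE] i := (qP i).2.
exists (\prod_i q i); first by apply/prodf_neq0 => i _; case: (qP i).
exists (\row_i ((\prod_(j | j != i) q j) * p i)).
apply/rowP => i; rewrite !mxE (bigD1 i) //= [q i * _]mulrC.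
by rewrite !rmorphM /= -mulrA pE.
Qed.

(** Clearing denominators turns a relation into [w *m A = 0]. By [predictable_degree] with [D = 0],
    a nonzero [w i] would satisfy [size (w i) + s i <= 1], although both summands are positive. *)
Lemma row_free_tofrac (F : fieldType) k n (A : 'M[{poly F}]_(k, n)) (s : 'I_k -> nat) :
  (forall i, 0 < s i)%N -> (forall i j, size (A i j) <= s i)%N ->
  row_free (\matrix_(i, j) (A i j)`_(s i).-1) ->
  row_free (map_mx (@FracField.tofrac _) A).
Proof.
move=> s0 As freeA; apply: inj_row_free => v vA.
have [q q0 [w wE]] := frac_row_clear_denom v.
have wA : w *m A = 0.
  have : map_mx (@FracField.tofrac _) (w *m A) = 0.
    by rewrite map_mxM -wE -scalemxAl vA scaler0.
  move=> /rowP wA; apply/rowP => j; have := wA j; rewrite mxE [RHS]mxE => /eqP.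
  by rewrite tofrac_eq0 [RHS]mxE => /eqP.
have w0 : w = 0.
  apply/rowP => i; rewrite [RHS]mxE; apply/eqP/negPn/negP => wi.
  suff : (size (w 0%R i) + s i <= 1)%N.
    by have := s0 i; move: wi; rewrite -size_poly_gt0; lia.
  apply: (predictable_degree s0 As freeA) wi => j.
  by have /rowP/(_ j) := wA; rewrite !mxE => ->; rewrite size_poly0.
move/eqP: wE; rewrite w0 map_mx0 scaler_eq0 tofrac_eq0 (negPf q0) /=.
by move/eqP.
Qed.

(** Row reduction gives [k] rows independent over the fraction field, hence [k <= r]; zero columns
    and rows pad the factors to inner size [r]. *)
Lemma rank_factorization m n r d (P : pmat m n) : PolyMatDR d r P ->
  exists (L : pmat m r) (A : pmat r n) (e : 'I_r -> nat),
    [/\ P = L *m A, forall i, (e i <= d)%N,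
        forall j i, (size (L j i) <= (d - e i).+1)%N
      & forall i j, (size (A i j) <= (e i).+1)%N].
Proof.
move=> [dP rkP]; have [k [L [A [M [s [PE AE s0 As freeA]]]]]] := row_reduction P.
have kr : (k <= r)%N.
  apply: leq_trans rkP; have /eqP <- := row_free_tofrac s0 As freeA.
  by rewrite AE map_mxM mxrankM_maxr.
(* Sizes exceed degrees by one, so [d.+2] means that the degrees add up to at most [d]. *)
have Ls j i : L j i != 0 -> (size (L j i) + s i <= d.+2)%N.
  apply: (predictable_degree s0 As freeA (w := L j)) => l.
  by have := dP j l; rewrite PE mxE.
(* [(M L - 1) A = M P - A = 0], and [A] has no nontrivial relation. Thus no column of [L] is zero,
   which yields [s i <= d.+1]. *)
have ML : M *m L = 1%:M.
  apply/eqP; rewrite -subr_eq0; apply/eqP/matrixP => i l; rewrite [RHS]mxE.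
  apply/eqP/negPn/negP => N0.
  suff : (size ((M *m L - 1%:M) i l)%R + s l <= 1)%N.
    rewrite leqNgt => /negP; apply.
    by rewrite -size_poly_gt0 in N0; exact: leq_add N0 (s0 l).
  apply: (predictable_degree s0 As freeA (w := (M *m L - 1%:M) i)) N0 => j.
  rewrite (_ : \sum_l _ = ((M *m L - 1%:M) *m A) i j); last by rewrite mxE.
  by rewrite mulmxBl mul1mx -mulmxA -PE -AE subrr mxE size_poly0.
have sd i : (s i <= d.+1)%N.
  have [j Lji] : exists j, L j i != 0.
    apply/existsP; rewrite -[[exists _, _]]negbK negb_exists; apply/negP => /forallP L0.
    have /matrixP/(_ i i)/eqP := ML; rewrite !mxE eqxx big1 => [|j _].
      by rewrite eq_sym oner_eq0.
    by have /negPn/eqP-> := L0 j; rewrite mulr0.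
  have := Ls _ _ Lji; have : (0 < size (L j i))%N by rewrite size_poly_gt0.
  lia.
rewrite -(subnKC kr).
exists (row_mx L 0), (col_mx A 0),
  (fun i => if split i is inl i' then (s i').-1 else 0%N).
split=> [|i|j i|i j].
- by rewrite mul_row_col mul0mx addr0.
- by case: splitP => // i' _; have := sd i'; lia.
- rewrite mxE; case: splitP => i' _; last by rewrite mxE size_poly0.
  have [->|/Ls] := eqVneq (L j i') 0; first by rewrite size_poly0.
  move=> le; rewrite -(leq_add2r (s i')) (leq_trans le) //.
  by have := s0 i'; have := sd i'; lia.
rewrite mxE; case: splitP => i' _; last by rewrite mxE size_poly0.
by rewrite prednK // As.
Qed.

(** * Perturbation to exact degrees *)

Lemma perturb_exact (p : {poly CC}) (e : nat) : (size p <= e.+1)%N ->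
  exists2 q : {poly CC}, (size q <= e.+1)%N &
    forall t : CC, t != 0 -> 1 + t != 0 ->
      (size (p + t%:P * q)%R <= e.+1)%N /\ (p + t%:P * q)`_e != 0.
Proof.
move=> pe; exists ((if p`_e == 0 then 1 else p`_e) *: 'X^e).
  by rewrite (leq_trans (size_scale_leq _ _)) // size_polyXn.
move=> t t0 t1; split.
  rewrite (leq_trans (size_polyD _ _)) // geq_max pe mul_polyC.
  by rewrite !(leq_trans (size_scale_leq _ _)) // size_polyXn.
rewrite coefD coefCM coefZ coefXn eqxx mulr1.
case: ifPn => [/eqP->|pn0]; first by rewrite mulr1 add0r.
by rewrite -{1}[p`_e]mul1r -mulrDl mulf_neq0.
Qed.

Lemma perturb_cols m r (L : pmat m r) (l : 'I_r -> nat) : (0 < m)%N ->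
  (forall j i, (size (L j i) <= (l i).+1)%N) ->
  exists2 E : pmat m r, (forall j i, (size (E j i) <= (l i).+1)%N) &
    forall t : CC, t != 0 -> 1 + t != 0 ->
      forall i, coldeg (L + t%:P *: E) i = Some (l i).
Proof.
case: m L => // m L _ Ls.
have qP i := perturb_exact (Ls ord0 i).
have /fin_all_exists[q {}qP] i : exists q : {poly CC}, (size q <= (l i).+1)%N /\
    forall t : CC, t != 0 -> 1 + t != 0 ->
      (size (L ord0 i + t%:P * q)%R <= (l i).+1)%N /\ (L ord0 i + t%:P * q)`_(l i) != 0.
  by have [q ? ?] := qP i; exists q.
exists (\matrix_(j, i) if j == ord0 then q i else 0) => [j i|t t0 t1 i].
  by rewrite mxE; case: ifP => _; [case: (qP i)|rewrite size_poly0].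
have [_ /(_ t t0 t1)[qs qe]] := qP i.
apply/vdegP; split=> [j|].
  rewrite !mxE; case: eqVneq => [->//|_]; by rewrite mulr0 addr0.
by exists ord0; rewrite !mxE eqxx.
Qed.

Lemma perturb_rows r n (A : pmat r n) (e : 'I_r -> nat) : (0 < n)%N ->
  (forall i j, (size (A i j) <= (e i).+1)%N) ->
  exists2 E : pmat r n, (forall i j, (size (E i j) <= (e i).+1)%N) &
    forall t : CC, t != 0 -> 1 + t != 0 ->
      forall i, rowdeg (A + t%:P *: E) i = Some (e i).
Proof.
move=> n0 As.
have [|E Es EA] := @perturb_cols n r A^T e n0; first by move=> j i; rewrite mxE.
exists E^T => [i j|t t0 t1 i]; first by rewrite mxE.
have /vdegP[sz [j ej]] := EA t t0 t1 i.
by apply/vdegP; split=> [j'|]; [have := sz j'|exists j; move: ej]; rewrite !mxE.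
Qed.

(** The factors are perturbed one after the other: each step is then affine in [t], as
    [pclosure_line] requires, and [pclosure_idem] joins the two. *)
Lemma bounded_sub_closure_profile m n r d (e : 'I_r -> nat)
    (L : pmat m r) (A : pmat r n) :
  (0 < m)%N -> (0 < n)%N -> (forall i, (e i <= d)%N) ->
  (forall j i, (size (L j i) <= (d - e i).+1)%N) ->
  (forall i j, (size (A i j) <= (e i).+1)%N) ->
  pclosure d (profile d e) (L *m A).
Proof.
move=> m0 n0 ed Ls As; have [E Es EL] := perturb_cols m0 Ls.
have [G Gs GA] := perturb_rows n0 As.
pose X (Q : pmat m n) := exists2 L' : pmat m r,
  (forall i, coldeg L' i = Some (d - e i)%N) & Q = L' *m A.
apply: (@pclosure_idem _ _ _ X) => [Q [L' L'd ->]|].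
  have L's j i : (size (L' j i) <= (d - e i).+1)%N by have /vdegP[] := L'd i.
  apply: (pclosure_line (E := L' *m G)) => [||t t0 t1].
  - exact: deg_le_mul As.
  - exact: deg_le_mul Gs.
  exists L', (A + t%:P *: G); rewrite mulmxDr -scalemxAr; split=> // i.
  by split; [|exact: GA|].
apply: (pclosure_line (E := E *m A)) => [||t t0 t1].
- exact: deg_le_mul As.
- exact: deg_le_mul As.
by exists (L + t%:P *: E); [exact: EL|rewrite mulmxDl -scalemxAl].
Qed.

Lemma PolyMatDR_sub_closure m n r d (P : pmat m n) :
  (0 < m)%N -> (0 < n)%N -> (0 < r)%N -> PolyMatDR d r P ->
  exists2 a : nat, (a <= r * d)%N & pclosure d (setB r d a) P.
Proof.
move=> m0 n0 r0 /rank_factorization[L [A [e [-> ed Ls As]]]].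
have ard : (\sum_(i < r) e i <= r * d)%N.
  by rewrite -[r in (r * d)%N]card_ord -sum_nat_const; apply: leq_sum.
exists (\sum_(i < r) e i)%N => //.
apply: pclosure_idem (bounded_sub_closure_profile m0 n0 ed Ls As) => Q prQ.
by apply: setA_sub_closure_setB => //; apply/setA_profile; exists e.
Qed.

(** * Closedness of the rank condition *)

(* If [v *m N = 0], then [v = v *m (M - N) *m M^-1], so the l1-norm of [v] is at
   most [delta * (\sum_(i, j) |M^-1 i j|)] times itself. *)
Lemma unitmx_open (F : numFieldType) k (M : 'M[F]_k) : M \in unitmx ->
  exists2 delta : F, 0 < delta &
    forall N : 'M[F]_k, (forall i j, `|M i j - N i j| < delta) -> N \in unitmx.
Proof.
move=> Mu; pose K := \sum_i \sum_j `|invmx M j i|.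
have K0 : 0 <= K by do 2!apply: sumr_ge0 => ? _.
have K1 : 0 < 1 + K by rewrite ltr_pwDl.
(* [K] can be 0, whereas [1 + K] is positive and [K / (1 + K) < 1], which makes the estimate on [S]
   contracting. *)
exists (1 + K)^-1; rewrite ?invr_gt0 // => N MN.
rewrite -row_free_unit; apply: inj_row_free => v vN.
pose S := \sum_j `|v 0 j|.
have S0 : 0 <= S by apply: sumr_ge0.
have vE : v = v *m (M - N) *m invmx M by rewrite mulmxBr vN subr0 mulmxK.
have vMN l : `|(v *m (M - N)) 0 l| <= S * (1 + K)^-1.
  rewrite mxE mulr_suml; apply: le_trans (ler_norm_sum _ _ _) _.
  apply: ler_sum => j _; rewrite normrM ler_wpM2l // ltW //.
  by have := MN j l; rewrite !mxE.
have SK : S <= S * (1 + K)^-1 * K.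
  rewrite /K mulr_sumr; apply: ler_sum => i _.
  rewrite {1}vE mxE mulr_sumr; apply: le_trans (ler_norm_sum _ _ _) _.
  by apply: ler_sum => l _; rewrite normrM ler_wpM2r.
have S_eq0 : S = 0.
  apply/le_anti; rewrite S0 andbT; move: SK.
  rewrite mulrAC ler_pdivlMr // mulrDr mulr1 gerDr //.
apply/rowP => j; rewrite [RHS]mxE; apply/eqP; rewrite -normr_eq0.
by move/eqP: S_eq0; rewrite psumr_eq0 // => /allP/(_ j); rewrite mem_index_enum; apply.
Qed.

Lemma rank_mxsub_le (F : fieldType) m n k l (f : 'I_k -> 'I_m) (g : 'I_l -> 'I_n)
  (A : 'M[F]_(m, n)) : (\rank (mxsub f g A) <= \rank A)%N.
Proof.
have -> : mxsub f g A = rowsub f 1%:M *m A *m colsub g 1%:M.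
  by rewrite -[in LHS](mulmx1 A) mxsub_mul -[in LHS](mul1mx A) -mul_rowsub_mx.
by rewrite (leq_trans (mxrankM_maxl _ _)) // mxrankM_maxr.
Qed.

(** A maximal set of independent rows is chosen first, then as many independent columns within
    it. *)
Lemma exists_unit_mxsub (F : fieldType) m n (A : 'M[F]_(m, n)) :
  exists (f : 'I_(\rank A) -> 'I_m) (g : 'I_(\rank A) -> 'I_n),
    mxsub f g A \in unitmx.
Proof.
have := maxrowsub_free A.
set f := maxrankfun A => freeB.
have fullB : row_full (rowsub f A)^T by rewrite /row_full mxrank_tr.
exists f, (fullrankfun fullB).
have := fullrowsub_unit fullB; rewrite -unitmx_tr.
by congr (_ \in unitmx); apply/matrixP => i j; rewrite !mxE.
Qed.

(** On polynomials of bounded degree, the value at [z] is at most the largest coefficient times the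
    sum [Z] of the powers of the norm of [z]. *)
Lemma horner_dist_lt (z : CC) (d : nat) (delta : CC) : 0 < delta ->
  exists2 eps : R, 0 < eps & forall p : {poly CC}, (size p <= d.+1)%N ->
    (forall k, (k <= d)%N -> sqmod p`_k < eps) -> `|p.[z]| < delta.
Proof.
move=> d0; pose Z := \sum_(k < d.+1) `|z| ^+ k.
have Z0 : 0 <= Z by apply: sumr_ge0 => k _; rewrite exprn_ge0.
have Z1 : 0 < 1 + Z by rewrite ltr_pwDl.
have eta0 : 0 < delta / (1 + Z) by rewrite divr_gt0.
have [eps eps0 epsP] := sqmod_small eta0.
exists eps => // p pd pe; rewrite (horner_coef_wide _ pd).
apply: le_lt_trans (ler_norm_sum _ _ _) _.
apply: (@le_lt_trans _ _ (delta / (1 + Z) * Z)).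
  rewrite mulr_sumr; apply: ler_sum => k _.
  rewrite normrM normrX ler_wpM2r ?exprn_ge0 // ltW // epsP // pe //.
  by rewrite -ltnS.
by rewrite mulrAC ltr_pdivrMr // ltr_pM2l // ltrDr.
Qed.

Lemma normal_rank_closed m n r d (P : pmat m n) :
  pclosure d (fun Q => normal_rank Q <= r)%N P -> (normal_rank P <= r)%N.
Proof.
move=> /pclosureP[dP clP]; rewrite leqNgt; apply/negP => lt_r.
have [f [g]] := exists_unit_mxsub (map_mx (@FracField.tofrac _) P).
rewrite -/(normal_rank P) => unit_fg.
pose ev z (Q : pmat m n) := map_mx (horner_eval z) (mxsub f g Q).
have evE (z : CC) Q : ev z Q \in unitmx ->
    mxsub f g (map_mx (@FracField.tofrac _) Q) \in unitmx.
  rewrite !unitmxE -map_mxsub !det_map_mx !unitfE tofrac_eq0.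
  by apply: contraNN => /eqP->; rewrite rmorph0.
(* The minor is a nonzero polynomial, and over an algebraically closed field such a polynomial has a
   non-root. *)
have [z zP] : exists z, ev z P \in unitmx.
  have : \det (mxsub f g P) != 0.
    by move: unit_fg; rewrite unitmxE -map_mxsub det_map_mx unitfE tofrac_eq0.
  move=> /closed_nonrootP[z zP]; exists z.
  by rewrite unitmxE det_map_mx unitfE.
have [delta delta0 deltaP] := unitmx_open zP.
have [eps eps0 epsP] := horner_dist_lt z d delta0.
have [Q [dQ rkQ ltQ]] := clP eps eps0.
have /evE : ev z Q \in unitmx.
  apply: deltaP => i j; rewrite !mxE /horner_eval -hornerN -hornerD.
  apply: epsP => [|k kd].
    by rewrite (leq_trans (size_polyD _ _)) // size_polyN geq_max dP dQ.
  have := sqmod_le_sqnorm (P - Q) (f i) (g j) kd; rewrite !mxE => le.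
  exact: le_lt_trans le ltQ.
(* [Q] now has an invertible submatrix of order [normal_rank P], which exceeds [r]. *)
rewrite -row_free_unit => /eqP rkE.
have := rank_mxsub_le f g (map_mx (@FracField.tofrac _) Q).
by rewrite rkE leqNgt (leq_ltn_trans rkQ lt_r).
Qed.

Lemma setB_normal_rank m n r d a (P : pmat m n) : setB r d a P -> (normal_rank P <= r)%N.
Proof.
case=> L [Rm [-> _]]; rewrite /normal_rank map_mxM.
by rewrite (leq_trans (mxrankM_maxl _ _)) // rank_leq_col.
Qed.

Theorem theorem4p8 (m n r d : nat) :
  (2 <= m)%N -> (2 <= n)%N -> (1 <= d)%N -> (0 < r)%N -> (r < minn m n)%N ->
  [/\ (forall a : nat, (a <= r * d)%N ->
         forall P : pmat m n, setB r d a P -> setA r d a P),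
      (forall a : nat, (a <= r * d)%N ->
         forall P : pmat m n, pclosure d (setB r d a) P <-> pclosure d (setA r d a) P),
      (forall P : pmat m n,
         PolyMatDR d r P <->
         exists2 a : nat, (a <= r * d)%N & pclosure d (setB r d a) P)
    & (forall P : pmat m n, PolyMatDR d r P ->
         exists2 a : nat, (a <= r * d)%N & pclosure d (setB r d a) P)].
Proof.
move=> m2 n2 _ r0 _.
have m0 : (0 < m)%N := ltnW m2; have n0 : (0 < n)%N := ltnW n2.
split=> [a ard P|a ard P|P|P]; first exact: setB_sub_setA.
- split; first by apply: pclosure_sub => Q; apply: setB_sub_setA.
  by apply: pclosure_idem => Q; apply: setA_sub_closure_setB.
- split=> [|[a _ clP]]; first exact: PolyMatDR_sub_closure.
  split; first by case: clP.
  by apply: normal_rank_closed (pclosure_sub _ clP) => Q; apply: setB_normal_rank.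
exact: PolyMatDR_sub_closure.
Qed.
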